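(* Let $\mathbb Y$ be a finite-dimensional Hilbert space, $A:\mathbb R^n\to\mathbb Y$ a surjective linear operator, $b\in\mathbb Y$, $\mathcal E=\{x\in\mathbb R^n:Ax=b\}$, and let $\mathcal K\subseteq\mathbb R^n$ be a closed set with $\mathcal F:=\mathcal K\cap\mathcal E\neq\emptyset$. Assume that (i) $\mathcal K$ is a $C^2$ embedded submanifold of $\mathbb R^n$; (ii) $\bar x\in\mathcal F$ satisfies the nondegeneracy condition $\operatorname{lin}\mathcal T_{\mathcal K}(\bar x)+\ker A=\mathbb R^n$ (equivalently $A(\operatorname{lin}\mathcal T_{\mathcal K}(\bar x))=\mathbb Y$). Then, for all $z$ sufficiently near $\bar x$, the dual problem $\min_{y\in\mathbb Y}\Phi_z(y)$ is locally strongly convex at its optimal solution.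
   Context: The primal problem is the projection problem $\min_{x\in\mathbb R^n}\{\tfrac12\|x-z\|^2: Ax=b,\ x\in\mathcal K\}$, and its dual objective is $\Phi_z(y)=-\langle b,y\rangle-\tfrac12\|z\|^2+\tfrac12\|z+A^*y\|^2-\tfrac12\operatorname{dist}(z+A^*y,\mathcal K)^2$ for $y\in\mathbb Y$, where $A^*$ is the adjoint of $A$. $\mathcal T_{\mathcal K}(\bar x)$ is the tangent cone to $\mathcal K$ at $\bar x$ (here the tangent space, a linear subspace), and $\operatorname{lin}(S)$ is the largest linear subspace contained in $S$. The dual problem is locally strongly convex at an optimal solution $y_z$ if there are $r,\mu>0$ such that $\Phi_z$ is strongly convex with modulus $\mu$ on the open ball of radius $r$ around $y_z$. *)

(* Defs.v *)
From HB Require Import structures.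
From mathcomp Require Import all_boot all_order all_algebra sesquilinear.
From mathcomp Require Import all_classical all_reals all_analysis.

Set Implicit Arguments.
Unset Strict Implicit.
Unset Printing Implicit Defensive.

Import Order.TTheory GRing.Theory Num.Theory.
Import numFieldNormedType.Exports.

Local Open Scope classical_set_scope.
Local Open Scope ring_scope.

(* Real inner products are the positive definite symmetric bilinear forms
   {dot V for idfun}. The library norm `|x| of 'rV[R]_n is the sup norm, so
   Euclidean lengths are always taken with [hnorm edot]; the topology of
   'rV[R]_n is the same for both norms. *)
Definition hnorm (R : realType) (V : lmodType R) (form : {dot V for idfun})
  (v : V) : R := Num.sqrt (form v v).

Definition edot (R : realType) (n : nat) (u v : 'rV[R]_n) : R :=
  \sum_(i < n) u 0 i * v 0 i.

Fact edotC (R : realType) n (u v : 'rV[R]_n) : edot u v = edot v u.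
Proof. by apply: eq_bigr => i _; rewrite mulrC. Qed.

Fact edot_is_bilinear (R : realType) n :
  bilinear_for ( *%R : GRing.Scale.law R R) (idfun \; *%R : GRing.Scale.law R R)
    (@edot R n).
Proof.
have edot_linear (w : 'rV[R]_n) : linear_for *%R (@edot R n w).
  move=> a u v; rewrite /edot mulr_sumr -big_split; apply: eq_bigr => i _ /=.
  by rewrite !mxE mulrDr mulrCA.
split=> [w a u v|w a u v]; last exact: edot_linear.
by rewrite ![edot _ w]edotC edot_linear.
Qed.

HB.instance Definition _ (R : realType) n :=
  bilinear_isBilinear.Build R _ _ _ _ _ (@edot R n) (edot_is_bilinear R n).

Fact edot_is_hermitian (R : realType) n (u v : 'rV[R]_n) :
  edot u v = (-1) ^+ false * idfun (edot v u).
Proof. by rewrite mul1r edotC. Qed.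

HB.instance Definition _ (R : realType) n :=
  isHermitianSesquilinear.Build R _ false idfun (@edot R n)
    (@edot_is_hermitian R n).

Fact edot_gt0 (R : realType) n (u : 'rV[R]_n) : u != 0 -> 0 < edot u u.
Proof.
have ge0 (i : 'I_n) : true -> 0 <= u 0 i * u 0 i by rewrite -expr2 sqr_ge0.
apply: contraNT; rewrite -leNgt => le0; apply/eqP/rowP => i; rewrite mxE.
have /(psumr_eq0P ge0)/(_ i isT)/eqP : edot u u = 0.
  by apply/eqP; rewrite eq_le le0 sumr_ge0.
by rewrite mulf_eq0 orbb => /eqP.
Qed.

HB.instance Definition _ (R : realType) n :=
  isDotProduct.Build _ _ (@edot R n) (@edot_gt0 R n).

Definition adj (R : realType) (n : nat) (Y : vectType R)
    (form : {dot Y for idfun}) (A : 'Hom('rV[R]_n, Y)) (y : Y) : 'rV[R]_n :=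
  \row_i form (A 'e_i) y.

Lemma adjP (R : realType) (n : nat) (Y : vectType R)
    (form : {dot Y for idfun}) (A : 'Hom('rV[R]_n, Y)) x y :
  edot x (adj form A y) = form (A x) y.
Proof.
have formC (u v : Y) : form u v = form v u.
  by rewrite [LHS]hermitian_subproof /= expr0 mul1r.
rewrite [in RHS](row_sum_delta x) linear_sum formC linear_sum.
by apply: eq_bigr => i _; rewrite !mxE !linearZ /= formC.
Qed.

Definition dist (R : realType) (n : nat) (w : 'rV[R]_n) (K : set 'rV[R]_n) : R :=
  inf [set hnorm (@edot R n) (w - x) | x in K].

Definition dual_objective (R : realType) (n : nat) (Y : vectType R)
    (form : {dot Y for idfun}) (A : 'Hom('rV[R]_n, Y)) (b : Y)
    (K : set 'rV[R]_n) (z : 'rV[R]_n) (y : Y) : R :=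
  - form b y - 2^-1 * hnorm (@edot R n) z ^+ 2
  + 2^-1 * hnorm (@edot R n) (z + adj form A y) ^+ 2
  - 2^-1 * dist (z + adj form A y) K ^+ 2.

(* Class C^k on an open set U, through iterated directional derivatives;
   the values of f and of its derivatives outside U play no role. *)
Fixpoint class_C (R : realType) (n m : nat) (k : nat) (U : set 'rV[R]_n)
    (f : 'rV[R]_n -> 'rV[R]_m) : Prop :=
  if k is k'.+1 then
    (forall x, U x -> differentiable f x) /\
    (forall v, class_C k' U ('D_v f))
  else forall x, U x -> {for x, continuous f}.

(* Embedded submanifold of R^n of dimension d and class C^k: near each of its
   points it is the zero set of a C^k submersion into R^(n-d). The library
   Jacobian acts on row vectors on the right, so that row_full says that the
   differential is onto. *)
Definition submanifold (R : realType) (n : nat) (k d : nat)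
    (K : set 'rV[R]_n) : Prop :=
  (d <= n)%N /\
  forall x, K x ->
    exists (U : set 'rV[R]_n) (h : 'rV[R]_n -> 'rV[R]_(n - d)),
      [/\ open U, U x, class_C k U h,
          forall u, U u -> row_full ('J h u) &
          K `&` U = [set u | h u = 0] `&` U].

(* Bouligand tangent cone. *)
Definition tangent_cone (R : realType) (n : nat) (K : set 'rV[R]_n)
    (x : 'rV[R]_n) : set 'rV[R]_n :=
  [set v | exists (t : nat -> R) (w : nat -> 'rV[R]_n),
     [/\ forall k, 0 < t k, t @ \oo --> (0 : R), w @ \oo --> v &
         forall k, K (x + t k *: w k)]].

Definition is_lin (R : realType) (n : nat) (S : set 'rV[R]_n)
    (L : {vspace 'rV[R]_n}) : Prop :=
  [set` L] `<=` S /\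
  forall M : {vspace 'rV[R]_n}, [set` M] `<=` S -> (M <= L)%VS.

Definition nondegenerate_at (R : realType) (n : nat) (Y : vectType R)
    (A : 'Hom('rV[R]_n, Y)) (K : set 'rV[R]_n) (x : 'rV[R]_n) : Prop :=
  exists2 L, is_lin (tangent_cone K x) L & (L + lker A)%VS = fullv.

Definition is_minimizer (R : realType) (T : Type) (f : T -> R) (y : T) : Prop :=
  forall y', f y <= f y'.

Definition strongly_convex_on (R : realType) (Y : lmodType R)
    (form : {dot Y for idfun}) (mu : R) (D : set Y) (f : Y -> R) : Prop :=
  forall y1 y2 t, D y1 -> D y2 -> 0 <= t <= 1 ->
    f (t *: y1 + (1 - t) *: y2) <=
      t * f y1 + (1 - t) * f y2
      - mu / 2 * t * (1 - t) * hnorm form (y1 - y2) ^+ 2.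

Definition locally_strongly_convex (R : realType) (Y : lmodType R)
    (form : {dot Y for idfun}) (f : Y -> R) (y : Y) : Prop :=
  exists r mu : R, [/\ 0 < r, 0 < mu &
    strongly_convex_on form mu [set y' | hnorm form (y' - y) < r] f].

(* Main.v *)
Require Import Defs.
From HB Require Import structures.
From mathcomp Require Import all_boot all_order all_algebra sesquilinear.
From mathcomp Require Import all_classical all_reals all_analysis.
From mathcomp Require Import ring lra.

(** Write [g w = max_(x in K) (<w, x> - |x|^2 / 2)], which is also
    [|w|^2 / 2 - dist(w, K)^2 / 2]. The dual objective is [g (z + A^* y)] plus
    an affine function of [y], hence convex, and a nearest point [x0] of [K] to
    [w0 = z + A^* y0] yields the subgradient [A x0 - b] at [y0]. Strong
    convexity on a ball follows once the subgradient inequality there gains a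
    quadratic term [mu / 2 * |y1 - y0|^2].

    That term comes from testing the maximum that defines [g (z + A^* y1)] at a
    point [x0 + a] of [K] other than [x0]. With [eta = y1 - y0], the gain is
    [<A^* eta, a> + <w0 - x0, a> - |a|^2 / 2] ([dual_objective_ge]).
    Nondegeneracy gives a linear right inverse [S] of [A] with values in the
    tangent space at the reference point ([tangent_section]). If [a] is close
    to [p = s *: S eta], the first term is about [s * |eta|^2], because
    [<A^* eta, S eta> = |eta|^2]. The second term must be bounded below by
    a multiple of [- s^2 * |eta|^2]. The vector [w0 - x0] is normal to [K] at
    [x0], a fact used in the following quantitative form: [K] also contains a
    point [x0 + a'] with [a'] close to [- p] and [a + a' = O(|p|^2)]
    ([submanifold_two_sided]), and minimality of [|w0 - x0|] at [x0 + a'] gives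
    [<w0 - x0, a'> <= |a'|^2 / 2]; so
    [<w0 - x0, a> >= - |a'|^2 / 2 - O(|p|^2)]. For a small constant [s] the
    linear term in [s] wins ([local_quadratic_growth]).

    The two points on [K] come from a Newton-type correction: with [B] a right
    inverse of the derivative of the defining submersion [h], the map
    [u |-> h (x0 + p + u *m B)] is close to the identity up to a constant, so it
    has a small zero by the contraction principle ([zero_set_two_sided]). Strict
    differentiability of [h] makes the corrections [o(|p|)]; the second
    derivative makes [a + a'] quadratic, through the bound
    [second_difference]. The tangent cone enters through its inclusion in the
    kernel of the derivative of [h] ([tangent_cone_ker]).

    Finally, at [z = xbar] the subgradient at [0] vanishes, so for [z] near
    [xbar] it is small and the quadratic growth dominates it on a small sphere;
    convexity propagates this outwards, and compactness provides the minimizer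
    ([unique_minimizer_of_local_growth]). *)

Set Implicit Arguments.
Unset Strict Implicit.
Unset Printing Implicit Defensive.

Import Order.TTheory GRing.Theory Num.Theory.
Import numFieldNormedType.Exports.

Local Open Scope classical_set_scope.
Local Open Scope ring_scope.

(** * Real inner products *)

Section InnerProduct.
Variables (R : realType) (V : lmodType R) (form : {dot V for idfun}).
Implicit Types (u v w : V) (a : R).

Lemma formC u v : form u v = form v u.
Proof. by rewrite [LHS]hermitian_subproof /= expr0 mul1r. Qed.

Lemma formDl u v w : form (u + v) w = form u w + form v w.
Proof. exact: linearDl. Qed.

Lemma formDr u v w : form w (u + v) = form w u + form w v.
Proof. exact: linearD. Qed.

Lemma formNl u w : form (- u) w = - form u w.
Proof. exact: linearNl. Qed.

Lemma formNr u w : form w (- u) = - form w u.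
Proof. exact: linearN. Qed.

Lemma formZl a u w : form (a *: u) w = a * form u w.
Proof. exact: linearZl_LR. Qed.

Lemma formZr a u w : form w (a *: u) = a * form w u.
Proof. by rewrite formC formZl formC. Qed.

Definition form_simp := (formDl, formDr, formNl, formNr, formZl, formZr).

Lemma form_ge0 u : 0 <= form u u.
Proof.
have [->|u0] := eqVneq u 0; first by rewrite linear0r.
exact/ltW/neq0_dnorm_gt0.
Qed.

Lemma hnorm_ge0 u : 0 <= hnorm form u.
Proof. exact: sqrtr_ge0. Qed.

Lemma sqr_hnorm u : hnorm form u ^+ 2 = form u u.
Proof. by rewrite sqr_sqrtr// form_ge0. Qed.

Lemma hnormZ a u : hnorm form (a *: u) = `|a| * hnorm form u.
Proof.
by rewrite /hnorm formZl formZr mulrA -expr2 sqrtrM ?sqr_ge0// sqrtr_sqr.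
Qed.

Lemma hnormN u : hnorm form (- u) = hnorm form u.
Proof. by rewrite /hnorm formNl formNr opprK. Qed.

Lemma hnorm_eq0 u : hnorm form u = 0 -> u = 0.
Proof.
move=> u0; apply/eqP; apply: contraT => /(@neq0_dnorm_gt0 _ _ _ form).
by rewrite -sqr_hnorm u0 expr0n ltxx.
Qed.

Lemma cauchy_schwarz u v : form u v <= hnorm form u * hnorm form v.
Proof.
set a := hnorm form u; set b := hnorm form v.
have := form_ge0 (b *: u - a *: v).
rewrite !form_simp (formC v u) -!sqr_hnorm -/a -/b.
have [a0 b0] : 0 <= a /\ 0 <= b by split; exact: hnorm_ge0.
have [/hnorm_eq0->|an0] := eqVneq a 0.
  by rewrite linear0l => _; rewrite mulr_ge0.
have [/hnorm_eq0->|bn0] := eqVneq b 0.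
  by rewrite linear0r => _; rewrite mulr_ge0.
have ab : 0 < a * b by rewrite mulr_gt0// lt0r ?an0 ?bn0.
move=> H; suff: a * b * form u v <= a * b * (a * b) by rewrite ler_pM2l.
nra.
Qed.

Lemma norm_cauchy_schwarz u v : `|form u v| <= hnorm form u * hnorm form v.
Proof.
rewrite ler_norml cauchy_schwarz andbT lerNl -formNl -(hnormN u).
exact: cauchy_schwarz.
Qed.

Lemma hnormD u v : hnorm form (u + v) <= hnorm form u + hnorm form v.
Proof.
rewrite -(@ler_pXn2r _ 2)// ?nnegrE ?addr_ge0 ?hnorm_ge0//.
rewrite sqr_hnorm !form_simp (formC v u) -!sqr_hnorm.
have := cauchy_schwarz u v; nra.
Qed.

(** The left-hand side is the value at [w + d] of the affine function
    [<., x> - |x|^2 / 2]; its excess over the value there of the affine function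
    attached to [x0] is the bracket, in which the increment [d] is separated from
    the residual [w - x0]. *)
Lemma quadratic_minorant_gap (w d x x0 : V) :
  2^-1 * form (w + d) (w + d) - 2^-1 * form (w + d - x) (w + d - x) =
  2^-1 * form w w - 2^-1 * form (w - x0) (w - x0) + form x0 d +
    (form d (x - x0) + form (w - x0) (x - x0) - 2^-1 * form (x - x0) (x - x0)).
Proof.
rewrite !form_simp (formC d w) (formC x w) (formC x d).
by rewrite (formC x0 w) (formC x0 d) (formC x0 x); field.
Qed.

End InnerProduct.

(** * A fixed-point lemma and the mean value inequality *)

(** Makes matrix spaces complete normed modules, as the contraction principle
    requires. *)
HB.instance Definition _ (R : realType) (m n : nat) :=
  Uniform_isComplete.Build 'M[R]_(m, n) cauchy_cvg.

Section Analysis.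
Variable R : realType.

Lemma norm_coord n (x : 'rV[R]_n) j : `|x 0 j| <= `|x|.
Proof.
by rewrite [leRHS]/Num.norm /= mx_normrE; apply/bigmax_geP; right; exists (0, j).
Qed.

Lemma norm_row_le n (x : 'rV[R]_n) c :
  0 <= c -> (forall j, `|x 0 j| <= c) -> `|x| <= c.
Proof.
move=> c0 xc; rewrite [leLHS]/Num.norm /= mx_normrE; apply/bigmax_leP.
by split=> // -[i j] _ /=; rewrite ord1.
Qed.

Lemma norm_mulmx n m (x : 'rV[R]_n) (M : 'M[R]_(n, m)) :
  `|x *m M| <= n%:R * `|M| * `|x|.
Proof.
apply: norm_row_le => [|j]; first by rewrite !mulr_ge0.
rewrite mxE (le_trans (ler_norm_sum _ _ _))//.
have -> : n%:R * `|M| * `|x| = \sum_(i < n) `|M| * `|x|.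
  by rewrite sumr_const card_ord -mulrA mulr_natl.
apply: ler_sum => i _.
rewrite normrM mulrC ler_pM// ?norm_coord//.
by rewrite [leRHS]/Num.norm /= mx_normrE; apply/bigmax_geP; right; exists (i, j).
Qed.

(** On the ball of radius [2 * |psi 0|] the map [u |-> u - psi u] is a
    contraction of ratio 1/2, and it maps this ball to itself; its fixed point
    is a zero of [psi]. *)
Lemma zero_of_near_identity m (psi : 'rV[R]_m -> 'rV[R]_m) (r : R) :
  (forall u v, `|u| <= r -> `|v| <= r ->
     `|(psi u - psi v) - (u - v)| <= 2^-1 * `|u - v|) ->
  2 * `|psi 0| <= r ->
  exists2 u, psi u = 0 & `|u| <= 2 * `|psi 0|.
Proof.
move=> psi_lip psi0; set r' := 2 * `|psi 0| in psi0 *.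
have r'0 : 0 <= r' by rewrite mulr_ge0.
pose U : set 'rV[R]_m := [set u | `|u| <= r'].
have UE : U = closed_ball_ Num.norm (0 : 'rV[R]_m) r'.
  by apply/seteqP; split=> u; rewrite /U /closed_ball_ /= sub0r normrN.
pose f (u : 'rV[R]_m) := u - psi u.
have f_lip u v : U u -> U v -> `|f u - f v| <= 2^-1 * `|u - v|.
  move=> Uu Uv; have -> : f u - f v = - ((psi u - psi v) - (u - v)).
    by apply/rowP=> i; rewrite !mxE; ring.
  by rewrite normrN psi_lip// (le_trans _ psi0).
have U0 : U 0 by rewrite /U /= normr0.
have fU : set_fun U U f.
  move=> u Uu /=; have := f_lip u 0 Uu U0.
  rewrite {2}/f sub0r opprK subr0 => fu.
  have := ler_normB (f u + psi 0) (psi 0); rewrite addrK => H.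
  have Uu' : `|u| <= r' := Uu.
  rewrite /U /=; rewrite /r' in Uu' *; lra.
have ctr : is_contraction (mkfun_fun fU).
  exists (2^-1)%:nng; split=> /=; first by lra.
  by move=> [u v] [/= Uu Uv]; exact: f_lip.
have Ucl : closed U by rewrite UE; exact: closed_closed_ball_.
have [u Uu fu] := banach_fixed_point ctr Ucl (ex_intro _ 0 U0).
exists u => //.
have : u - psi u = u by exact: esym fu.
by move/(congr1 (fun x => u - x)); rewrite subrr opprB addrC subrK.
Qed.

(** The difference quotients of the scalar function are the coordinates of the
    directional difference quotients of [f]. *)
Lemma is_derive_coord_line n m (f : 'rV[R]_n -> 'rV[R]_m) z v t j :
  differentiable f (z + t *: v) ->
  is_derive t 1 (fun s => f (z + s *: v) 0 j) ('D_v f (z + t *: v) 0 j).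
Proof.
move=> df; have /cvg_ex[l fl] : derivable f (z + t *: v) v by exact: diff_derivable.
have -> : 'D_v f (z + t *: v) = l by apply: cvg_lim fl; exact: norm_hausdorff.
set F := fun s => _.
suff H : (fun h => h^-1 *: (F (h *: 1 + t) - F t)) @ 0^' --> l 0 j.
  apply: DeriveDef; first by apply/cvg_ex; exists (l 0 j).
  by apply: cvg_lim H; exact: norm_hausdorff.
have -> : (fun h => h^-1 *: (F (h *: 1 + t) - F t)) =
    (fun x : 'rV[R]_m => x 0 j) \o
    (fun h => h^-1 *: ((f \o shift (z + t *: v)) (h *: v) - f (z + t *: v))).
  apply/funext => h /=; rewrite !mxE /F; congr (_ * (f _ 0 j - _)).
  by rewrite [h%:A]mulr1 scalerDl addrCA.
apply: cvg_comp fl _; exact: coord_continuous.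
Qed.

(** In the sup norm the mean value theorem applies coordinate by coordinate:
    each coordinate may use its own intermediate point. *)
Lemma mean_value_le n m (f : 'rV[R]_n -> 'rV[R]_m) (z v : 'rV[R]_n)
    (w : 'rV[R]_m) (c : R) :
  (forall t : R, 0 <= t <= 1 -> differentiable f (z + t *: v)) ->
  (forall t : R, 0 <= t <= 1 -> `|'D_v f (z + t *: v) - w| <= c) ->
  `|f (z + v) - f z - w| <= c.
Proof.
move=> df dfc; have c0 : 0 <= c.
  by apply: le_trans (dfc 0 _); rewrite ?lexx ?ler01.
apply: norm_row_le => // j.
pose g (s : R) : R := f (z + s *: v) 0 j.
have D (t : R) : 0 <= t <= 1 -> is_derive t 1 g ('D_v f (z + t *: v) 0 j).
  by move=> /df; exact: is_derive_coord_line.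
have [t||s st] := @MVT_segment R g (fun s => 'D_v f (z + s *: v) 0 j) 0 1 ler01.
- by rewrite in_itv /= => /andP[t0 t1]; apply: D; rewrite !ltW.
- apply: derivable_within_continuous => s; rewrite in_itv /= => /D H.
  exact: ex_derive.
rewrite /g scale0r addr0 scale1r subr0 mulr1 => E.
rewrite !mxE E; apply: le_trans (dfc s st).
by apply: le_trans (norm_coord _ j); rewrite !mxE.
Qed.
End Analysis.

(** * Strict differentiability and second differences *)

Section StrictDerivative.
Variables (R : realType) (n m : nat) (U : set 'rV[R]_n).
Hypothesis openU : open U.
Implicit Types (f : 'rV[R]_n -> 'rV[R]_m) (x y z v q : 'rV[R]_n).

Lemma derive_sum_coord f x v : differentiable f x ->
  'D_v f x = \sum_(i < n) v 0 i *: 'D_('e_i) f x.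
Proof.
move=> df; rewrite deriveEjacobian// {1}(row_sum_delta v) mulmx_suml.
by apply: eq_bigr => i _; rewrite -scalemxAl deriveEjacobian.
Qed.

(** A bound uniform in the direction [v] needs only the continuity of the
    finitely many partial derivatives. *)
Lemma derive_near f x (e : R) : class_C 1 U f -> U x -> 0 < e ->
  \forall y \near x, U y /\ forall v, `|'D_v f y - v *m 'J f x| <= e * `|v|.
Proof.
move=> [df cDf] Ux e0; pose e' := e / n.+1%:R.
have e'0 : 0 < e' by rewrite divr_gt0.
near=> y; have Uy : U y by near: y; exact: open_nbhs_nbhs.
split=> // v; rewrite -deriveEjacobian; last exact: df.
rewrite !derive_sum_coord; [|exact: df..].
rewrite -sumrB (le_trans (ler_norm_sum _ _ _))//.
apply: (@le_trans _ _ (\sum_(i < n) e' * `|v|)).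
  apply: ler_sum => i _; rewrite -scalerBr normrZ mulrC ler_pM// ?norm_coord//.
  rewrite distrC; move: i; near: y.
  apply: filter_forall => i.
  have /cvgrPdist_le/(_ _ e'0) : {for x, continuous ('D_('e_i) f)} by exact: cDf.
  exact.
rewrite sumr_const card_ord -mulrnAl ler_wpM2r// /e' -mulr_natr mulrAC.
by rewrite ler_pdivrMr// ler_pM2l// ler_nat.
Unshelve. all: by end_near. Qed.

(** The mean value inequality on the segment from [z] to [y], on which the
    derivative stays [e]-close to the one at [x]. *)
Lemma strict_derivative f x (e : R) : class_C 1 U f -> U x -> 0 < e ->
  exists2 d : R, 0 < d & forall y z, `|y - x| < d -> `|z - x| < d ->
    `|f y - f z - (y - z) *m 'J f x| <= e * `|y - z|.
Proof.
move=> Cf Ux e0; have /nbhs_normP[d /= d0 dP] := derive_near Cf Ux e0.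
exists d => // y z yd zd.
have seg t : 0 <= t <= 1 -> `|x - (z + t *: (y - z))| < d.
  move=> /andP[t0 t1].
  have -> : x - (z + t *: (y - z)) = (1 - t) *: (x - z) + t *: (x - y).
    by apply/rowP => i; rewrite !mxE; ring.
  rewrite (le_lt_trans (ler_normD _ _))// !normrZ !ger0_norm ?subr_ge0//.
  rewrite ![`|x - _|]distrC.
  have [M [yM zM Md]] : exists M, [/\ `|y - x| <= M, `|z - x| <= M & M < d].
    by exists (Num.max `|y - x| `|z - x|); rewrite !le_max !lexx orbT gt_max yd.
  nra.
rewrite {1}(_ : y = z + (y - z)); last by rewrite addrC subrK.
apply: mean_value_le => t /seg /dP[Ut].
- by move=> _; exact: Cf.1.
- exact.
Qed.

Lemma lipschitz_near f x : class_C 1 U f -> U x ->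
  exists2 d : R, 0 < d & exists2 L : R, 0 <= L &
  forall y z, `|y - x| < d -> `|z - x| < d -> `|f y - f z| <= L * `|y - z|.
Proof.
move=> Cf Ux; have [d d0 dP] := strict_derivative Cf Ux ltr01.
exists d => //; exists (1 + n%:R * `|'J f x|) => [|y z yd zd].
  by rewrite addr_ge0// mulr_ge0.
rewrite -(subrK ((y - z) *m 'J f x) (f y - f z)) mulrDl.
by rewrite (le_trans (ler_normD _ _))// lerD ?dP// norm_mulmx.
Qed.

(** The second difference is the sum of two first-order Taylor remainders, in
    the directions [q] and [- q], whose linear terms cancel. Each remainder is
    quadratic since the partial derivatives are Lipschitz near [x]. *)
Lemma second_difference f x : class_C 2 U f -> U x ->
  exists2 d : R, 0 < d & exists2 L : R, 0 <= L &
  forall y q, `|y - x| < d -> `|q| < d ->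
    `|f (y + q) + f (y - q) - f y - f y| <= L * `|q| ^+ 2.
Proof.
move=> [df C1] Ux.
have /fin_all_exists2[d d0 /fin_all_exists2[L L0 dL]] :
    forall i : 'I_n, exists2 d : R, 0 < d & exists2 L : R, 0 <= L &
  forall y z, `|y - x| < d -> `|z - x| < d ->
    `|'D_('e_i) f y - 'D_('e_i) f z| <= L * `|y - z|.
  by move=> i; apply: lipschitz_near.
have /nbhs_normP[d1 /= d10 d1U] := open_nbhs_nbhs (conj openU Ux).
pose D := \big[Num.min/d1]_(i < n) d i.
have D0 : 0 < D by apply/lt_bigmin.
pose S := \sum_i L i; have S0 : 0 <= S by apply: sumr_ge0.
exists (D / 2); first by rewrite divr_gt0.
exists (2 * S) => [|y q yD qD]; first by rewrite mulr_ge0.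
have in_D t q' : 0 <= t <= 1 -> `|q'| < D / 2 -> `|y + t *: q' - x| < D.
  move=> /andP[t0 t1] q'D; rewrite addrAC (le_lt_trans (ler_normD _ _))//.
  rewrite normrZ ger0_norm//; have := normr_ge0 q'; nra.
have in_U z : `|z - x| < D -> U z.
  by move=> zD; apply: d1U; rewrite /= distrC (lt_le_trans zD) ?bigmin_le_id.
have half q' : `|q'| < D / 2 -> `|f (y + q') - f y - 'D_q' f y| <= S * `|q'| ^+ 2.
  move=> q'D; have y0 : `|y - x| < D by lra.
  apply: mean_value_le => t t01; have tD := in_D t q' t01 q'D.
    by apply: df; apply: in_U.
  rewrite !derive_sum_coord; [|apply: df; exact: in_U..].
  rewrite -sumrB (le_trans (ler_norm_sum _ _ _))// /S mulr_suml.
  apply: ler_sum => i _; rewrite -scalerBr normrZ expr2 mulrCA.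
  apply: ler_pM => //; first exact: norm_coord.
  have Di z : `|z - x| < D -> `|z - x| < d i.
    by move=> zD; rewrite (lt_le_trans zD)// bigmin_le.
  rewrite (le_trans (dL i _ _ (Di _ tD) (Di _ y0)))// ler_wpM2l//.
  rewrite addrC addKr normrZ; case/andP: t01 => t0 t1.
  by rewrite ger0_norm// ler_piMl.
have -> : f (y + q) + f (y - q) - f y - f y =
    (f (y + q) - f y - 'D_q f y) + (f (y - q) - f y - 'D_(- q) f y).
  have Uy : U y by apply: in_U; lra.
  rewrite !deriveEjacobian; [|exact: df..].
  by apply/rowP => i; rewrite mulNmx !mxE; ring.
rewrite (le_trans (ler_normD _ _))// -mulrA mulr_natl mulr2n lerD ?half//.
by rewrite -[leRHS]/(S * `|q| ^+ 2) -(normrN q) half// normrN.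
Qed.
End StrictDerivative.

(** * Moving along the zero set of a submersion *)

Section ZeroSet.
Variables (R : realType) (n m : nat) (U : set 'rV[R]_n).
Variables (h : 'rV[R]_n -> 'rV[R]_m) (xb : 'rV[R]_n).
Hypotheses (openU : open U) (Ux : U xb) (h_C2 : class_C 2 U h).
Hypothesis h_submersion : row_full ('J h xb).

Lemma class_C2_C1 : class_C 1 U h.
Proof.
case: h_C2 => dh Ch; split=> // v x /(proj1 (Ch v) x).
exact: differentiable_continuous.
Qed.

(** The point [x0 + p] is corrected to a zero of [h] along the range of a right
    inverse [B] of the derivative, and so is [x0 - p]. Since [p] is in the
    kernel of the derivative at [xb], the defect [h (x0 + p)] is [o(|p|)], and
    so are the corrections. The sum [a + a'] is quadratic: [h] vanishes at
    [x0], [x0 + a] and [x0 + a'], so the second-difference bound gives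
    [h (x0 - a) = O(|a|^2)], while strict differentiability compares
    [h (x0 + a') - h (x0 - a)] to the derivative of [h] along [a + a'], which is
    in the range of [B]. *)
Lemma zero_set_two_sided (e : R) : 0 < e ->
  exists2 d : R, 0 < d & exists2 C : R, 0 <= C &
  forall x0 p, h x0 = 0 -> `|x0 - xb| < d -> p *m 'J h xb = 0 -> `|p| < d ->
  exists a a' : 'rV[R]_n,
    [/\ h (x0 + a) = 0 /\ U (x0 + a), h (x0 + a') = 0 /\ U (x0 + a'),
        `|a - p| <= e * `|p|, `|a' + p| <= e * `|p| &
        `|a + a'| <= C * `|p| ^+ 2].
Proof.
move=> e0; have /row_fullP[B BJ] := h_submersion.
set J := 'J h xb in BJ *.
pose b : R := m%:R * `|B| + 1.
have b0 : 0 < b by rewrite ltr_wpDl// mulr_ge0.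
have bP (u : 'rV[R]_m) : `|u *m B| <= b * `|u|.
  by rewrite (le_trans (norm_mulmx _ _))// /b mulrDl mul1r lerDl.
(* The bound on e1 makes both corrected maps contract by 1/2 and keeps the
   corrections below e * |p|. *)
have [e1 [e10 e1b e1e]] : exists e1 : R, [/\ 0 < e1, 2 * e1 * b <= 1 & 2 * e1 * b <= e].
  exists (Num.min 1 e / (2 * b)).
  have -> : 2 * (Num.min 1 e / (2 * b)) * b = Num.min 1 e.
    by field; rewrite gt_eqF.
  by rewrite !ge_min !lexx orbT divr_gt0// ?mulr_gt0// lt_min ltr01.
have [d1 d10 strict] := strict_derivative openU class_C2_C1 Ux e10.
have [d2 d20 [L L0 second]] := second_difference openU h_C2 Ux.
have /nbhs_normP[d3 /= d30 d3U] := open_nbhs_nbhs (conj openU Ux).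
have [d [d0 dd1 dd2 dd3]] : exists d : R, [/\ 0 < d, d <= d1, d <= d2 & d <= d3].
  exists (Num.min d1 (Num.min d2 d3)).
  by rewrite !ge_min !lt_min !lexx !orbT d10 d20 d30.
have d4 : 0 < d / 4 by rewrite divr_gt0.
exists (d / 4) => //; exists (b * (8 * L)).
  by rewrite !mulr_ge0// ltW.
move=> x0 p hx0 x0d pJ pd.
have near3 v w : `|v| < d / 4 -> `|w| <= d / 4 -> `|x0 + (v + w) - xb| < d.
  move=> vd wd; rewrite addrAC (le_lt_trans (ler_normD _ _))//.
  have := ler_normD v w; lra.
have correct v : v *m J = 0 -> `|v| < d / 4 ->
    exists2 u, h (x0 + (v + u *m B)) = 0 & `|u| <= 2 * (e1 * `|v|).
  move=> vJ vd; pose psi u := h (x0 + (v + u *m B)).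
  have psi0 : `|psi 0| <= e1 * `|v|.
    have x0v : `|x0 + v - xb| < d1.
      by rewrite (lt_le_trans _ dd1)// -(addr0 v) near3// normr0 ltW.
    have := strict _ _ x0v (lt_le_trans x0d _).
    rewrite hx0 subr0 (addrC x0) addrK vJ subr0 /psi mul0mx addr0 (addrC x0).
    by apply; apply: le_trans dd1; lra.
  have wB (u : 'rV[R]_m) : `|u| <= d / (4 * b) -> `|u *m B| <= d / 4.
    move=> ud; rewrite (le_trans (bP u))// mulrC -ler_pdivlMr//.
    by rewrite (le_trans ud)// invfM mulrA.
  have [u w ur wr||u ? ur] := @zero_of_near_identity R m psi (d / (4 * b)).
  - have uB := wB _ ur; have wB' := wB _ wr.
    have := strict _ _ (lt_le_trans (near3 _ _ vd uB) dd1)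
      (lt_le_trans (near3 _ _ vd wB') dd1).
    have -> : x0 + (v + u *m B) - (x0 + (v + w *m B)) = (u - w) *m B.
      by rewrite mulmxBl; apply/rowP => i; rewrite !mxE; ring.
    rewrite -mulmxA BJ mulmx1 => /le_trans; apply.
    have := bP (u - w); have := normr_ge0 (u - w); nra.
  - rewrite ler_pdivlMr ?mulr_gt0//.
    have := normr_ge0 v; nra.
  - exists u => //; rewrite (le_trans ur)//; lra.
have small (v : 'rV[R]_n) (u : 'rV[R]_m) : `|v| < d / 4 -> `|u| <= 2 * (e1 * `|v|) ->
    `|u *m B| <= e * `|v| /\ `|u *m B| <= `|v|.
  have := bP u; have := normr_ge0 v; move: e1b e1e b0; clear.
  move: (`|v|) (`|u|) (`|u *m B|) => v' u' w' *; split; nra.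
have [u hu ur] := correct p pJ pd.
have NpJ : - p *m J = 0 by rewrite mulNmx pJ oppr0.
have Npd : `|- p| < d / 4 by rewrite normrN.
have [u' hu' ur'] := correct (- p) NpJ Npd.
have [uBe uBp] := small _ _ pd ur.
have [] := small _ _ Npd ur'; rewrite normrN => uBe' uBp'.
have uB4 : `|u *m B| <= d / 4 by rewrite (le_trans uBp)// ltW.
have uB4' : `|u' *m B| <= d / 4 by rewrite (le_trans uBp')// ltW.
have inU y : `|y - xb| < d -> U y.
  by move=> yd; apply: d3U; rewrite /= distrC (lt_le_trans yd).
exists (p + u *m B), (- p + u' *m B); split.
- by split=> //; apply: inU; exact: near3.
- by split=> //; apply: inU; exact: near3.
- by rewrite addrC addKr.
- by rewrite addrAC addNr add0r.
set a := p + u *m B.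
(* The directions p and - p cancel: only the corrections remain. *)
have aE : a - p + p + (- p + u' *m B) = (u + u') *m B.
  by rewrite mulmxDl /a; apply/rowP => i; rewrite !mxE; ring.
have -> : a + (- p + u' *m B) = (u + u') *m B by rewrite -aE subrK.
have ap : `|a| <= 2 * `|p|.
  by rewrite (le_trans (ler_normD _ _))// mulr_natl mulr2n lerD2l.
have hxa : `|h (x0 - a)| <= L * `|a| ^+ 2.
  have := second x0 a; rewrite hu hx0 add0r !subr0; apply; lra.
have := strict (x0 + (- p + u' *m B)) (x0 - a).
have -> : x0 + (- p + u' *m B) - (x0 - a) = (u + u') *m B.
  by rewrite mulmxDl /a; apply/rowP => i; rewrite !mxE; ring.
rewrite -/J -mulmxA BJ mulmx1 hu' sub0r => /(_ (lt_le_trans (near3 _ _ Npd uB4') dd1)).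
have x0a : `|x0 - a - xb| < d1.
  rewrite addrAC (le_lt_trans (ler_normD _ _))// normrN; lra.
move=> /(_ x0a) st.
(* The term in e1 is absorbed by the left-hand side, as e1 * b <= 1/2. *)
have uu' : `|u + u'| <= L * `|a| ^+ 2 + e1 * `|(u + u') *m B|.
  have := ler_normD (h (x0 - a)) (- h (x0 - a) - (u + u')).
  rewrite addrA subrr sub0r normrN; lra.
have := bP (u + u').
have a2 : `|a| ^+ 2 <= 4 * `|p| ^+ 2.
  have := normr_ge0 a; nra.
have La : L * `|a| ^+ 2 <= L * (4 * `|p| ^+ 2) by rewrite ler_wpM2l.
move: (normr_ge0 (u + u')) uu' e1b La b0 e10; clear.
move: (`|u + u'|) (`|(u + u') *m B|) (L * `|a| ^+ 2) (`|p| ^+ 2) => s t q r.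
move=> s0 H1 H2 H3 H4 H5 H6.
suff : s <= 8 * L * r 
  by move=> H; apply: (le_trans H6); rewrite -mulrA ler_wpM2l// ltW.
have e1t : e1 * t <= e1 * (b * s) by rewrite ler_wpM2l// ltW.
have : 2 * e1 * b * s <= 1 * s by rewrite ler_wpM2r.
lra.
Qed.
End ZeroSet.

(** * Euclidean norm, distance and nearest points *)

Section Euclidean.
Variables (R : realType) (n : nat).
Implicit Types (u v w x : 'rV[R]_n) (K : set 'rV[R]_n).

Local Notation N := (hnorm (@edot R n)).

Lemma norm_edot_le u v : `|edot u v| <= n%:R * (`|u| * `|v|).
Proof.
rewrite (le_trans (ler_norm_sum _ _ _))//.
apply: (@le_trans _ _ (\sum_(i < n) `|u| * `|v|)).
  by apply: ler_sum => i _; rewrite normrM ler_pM// norm_coord.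
by rewrite sumr_const card_ord mulr_natl.
Qed.

Lemma norm_le_hnorm u : `|u| <= N u.
Proof.
apply: norm_row_le => [|j]; first exact: hnorm_ge0.
rewrite -sqrtr_sqr ler_wsqrtr// -[leRHS]/(\sum_i u 0 i * u 0 i).
rewrite (bigD1 j)//= -expr2 lerDl sumr_ge0// => i _.
by rewrite -expr2 sqr_ge0.
Qed.

Lemma hnorm_le_norm u : N u <= n%:R * `|u|.
Proof.
rewrite -(@ler_pXn2r _ 2)// ?nnegrE ?hnorm_ge0 ?mulr_ge0//.
rewrite sqr_hnorm (le_trans (ler_norm _))// (le_trans (norm_edot_le u u))//.
rewrite exprMn -expr2 ler_wpM2r ?sqr_ge0//.
by rewrite -natrX ler_nat; case: (n) => // k; rewrite leq_pmulr.
Qed.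

Lemma hnorm_lipschitz u v : `|N u - N v| <= n%:R * `|u - v|.
Proof.
rewrite (le_trans _ (hnorm_le_norm _))// ler_norml.
have := hnormD (@edot R n) (u - v) v; rewrite subrK.
have := hnormD (@edot R n) (v - u) u; rewrite subrK -(hnormN _ (v - u)) opprB.
lra.
Qed.

Lemma continuous_of_lipschitz (f : 'rV[R]_n -> R) (c : R) :
  (forall x y, `|f x - f y| <= c * `|x - y|) -> continuous f.
Proof.
move=> fc x; apply/(@cvgrPdist_lt _ _ _ (nbhs x) (nbhs_filter x)) => e e0.
have c0 : 0 < `|c| + 1 by rewrite ltr_wpDl.
apply/(@nbhs_normP R 'rV[R]_n x); exists (e / (`|c| + 1)); first exact: divr_gt0.
move=> y; rewrite /= ltr_pdivlMr// mulrC => xy; rewrite (le_lt_trans (fc x y))//.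
rewrite (le_lt_trans _ xy)// ler_wpM2r// (le_trans (ler_norm c))// lerDl.
exact: ler01.
Qed.

(** The Euclidean distance to [w] attains its minimum on a compact piece of [K],
    cut out by a sup-norm ball outside of which all points are
    Euclidean-farther from [w] than a given point of [K]. *)
Lemma nearest_point K w : closed K -> K !=set0 ->
  exists2 x0, K x0 & forall x, K x -> N (w - x0) <= N (w - x).
Proof.
move=> Kcl [x1 Kx1].
pose C := K `&` closed_ball_ Num.norm w (N (w - x1)).
have Ccl : closed C by apply: closedI => //; exact: closed_closed_ball_.
have Cbd : bounded_set C.
  exists (`|w| + N (w - x1)); split; first exact: num_real.
  move=> M HM x [_ xw]; apply: le_trans (ltW HM).
  rewrite -(subrK w x) addrC (le_trans (ler_normD _ _))// lerD2l distrC.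
  exact: xw.
have Nc : continuous (fun x => N (w - x)).
  apply: (@continuous_of_lipschitz _ n%:R) => x y.
  rewrite (le_trans (hnorm_lipschitz _ _))// ler_wpM2l//.
  by rewrite opprB addrC subrKA distrC.
have Cx1 : C x1 by split=> //; exact: norm_le_hnorm.
have [x0 Cx0 x0min] := compact_EVT_min (ex_intro _ x1 Cx1)
  (bounded_closed_compact Cbd Ccl) (continuous_subspaceT Nc).
move/set_mem: Cx0 => [Kx0 _]; exists x0 => // x Kx.
have [xle|xgt] := leP `|w - x| (N (w - x1)).
  by apply: x0min; apply/mem_set; split.
rewrite (le_trans (x0min x1 (mem_set Cx1)))// ltW//.
by rewrite (lt_le_trans xgt)// norm_le_hnorm.
Qed.

Lemma dist_le K w x : K x -> dist w K <= N (w - x).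
Proof.
move=> Kx; apply: ge_inf; last by exists x.
by exists 0 => _ [y _ <-]; exact: hnorm_ge0.
Qed.

Lemma dist_nearest K w x0 : K x0 ->
  (forall x, K x -> N (w - x0) <= N (w - x)) -> dist w K = N (w - x0).
Proof.
move=> Kx0 x0min; apply/eqP; rewrite eq_le dist_le//=.
apply: lb_le_inf; first by exists (N (w - x0)), x0.
by move=> _ [x Kx <-]; exact: x0min.
Qed.

Lemma dist_lipschitz K u v : closed K -> K !=set0 ->
  `|dist u K - dist v K| <= n%:R * `|u - v|.
Proof.
move=> Kcl K0.
suff H a b : dist a K - dist b K <= n%:R * `|a - b|.
  by rewrite ler_norml H andbT lerNl opprB distrC H.
have [x0 Kx0 x0min] := nearest_point b Kcl K0.
rewrite (dist_nearest Kx0 x0min) lerBlDr (le_trans (dist_le a Kx0))//.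
have := hnormD (@edot R n) (a - b) (b - x0); rewrite addrA subrK.
have := hnorm_le_norm (a - b); lra.
Qed.
End Euclidean.

(** * The dual objective *)

Section Dual.
Variables (R : realType) (n : nat) (Y : vectType R) (form : {dot Y for idfun}).
Variables (A : 'Hom('rV[R]_n, Y)) (b : Y) (K : set 'rV[R]_n).
Hypotheses (K_closed : closed K) (K_nonempty : K !=set0).

Local Notation N := (hnorm (@edot R n)).
Local Notation Phi := (dual_objective form A b K).
Local Notation "A^*" := (adj form A).

Lemma adj_is_linear : linear (adj form A).
Proof. by move=> a u v; apply/rowP => i; rewrite !mxE formDr formZr. Qed.

HB.instance Definition _ :=
  GRing.isLinear.Build R Y 'rV[R]_n _ (adj form A) adj_is_linear.

(** The distance from [z + A^* y1] to [K] is at most the distance to the test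
    point [x], whereas at [y0] it is attained at [x0]. *)
Lemma dual_objective_ge z y0 y1 x0 x : K x0 ->
    (forall x', K x' -> N (z + A^* y0 - x0) <= N (z + A^* y0 - x')) -> K x ->
  Phi z y0 + form (A x0 - b) (y1 - y0) +
    (edot (A^* (y1 - y0)) (x - x0) + edot (z + A^* y0 - x0) (x - x0)
     - 2^-1 * edot (x - x0) (x - x0)) <= Phi z y1.
Proof.
move=> Kx0 x0min Kx.
rewrite /dual_objective (dist_nearest Kx0 x0min).
have : dist (z + A^* y1) K ^+ 2 <= N (z + A^* y1 - x) ^+ 2.
  rewrite ler_pXn2r ?nnegrE ?hnorm_ge0 ?dist_le//.
  apply: lb_le_inf => [|_ [x' _ <-]]; last exact: hnorm_ge0.
  by exists (N (z + A^* y1 - x)), x.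
have -> : A^* y1 = A^* y0 + A^* (y1 - y0) by rewrite -linearD addrC subrK.
rewrite !sqr_hnorm [form (A x0 - b) _]formDl [form (- b) _]formNl.
rewrite -[form (A x0) _]adjP.
set d := A^* (y1 - y0); set w := z + A^* y0.
rewrite [z + (_ + d)]addrA -/w.
have := quadratic_minorant_gap (@edot R n) w d x x0.
have -> : form b y1 = form b y0 + form b (y1 - y0) by rewrite -formDr addrC subrK.
rewrite /=; lra.
Qed.

Lemma dual_objective_subgradient z y0 y1 x0 : K x0 ->
    (forall x', K x' -> N (z + A^* y0 - x0) <= N (z + A^* y0 - x')) ->
  Phi z y0 + form (A x0 - b) (y1 - y0) <= Phi z y1.
Proof.
move=> Kx0 x0min; have := dual_objective_ge y1 Kx0 x0min Kx0.
have e0 u : edot u (0 : 'rV[R]_n) = 0 :> R by exact: linear0r.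
by rewrite subrr !e0 mulr0 subr0 !addr0.
Qed.

Lemma norm_adj_le : exists2 c : R, 0 <= c & forall y, `|A^* y| <= c * hnorm form y.
Proof.
exists (\sum_(i < n) hnorm form (A 'e_i)) => [|y].
  by apply: sumr_ge0 => i _; exact: hnorm_ge0.
apply: norm_row_le => [|j].
  by rewrite mulr_ge0 ?hnorm_ge0// sumr_ge0// => i _; exact: hnorm_ge0.
rewrite mxE (le_trans (norm_cauchy_schwarz _ _ _))// ler_wpM2r ?hnorm_ge0//.
by rewrite (bigD1 j)//= lerDl sumr_ge0// => i _; exact: hnorm_ge0.
Qed.

Lemma hnorm_lfun_le : exists2 c : R, 0 <= c & forall x, hnorm form (A x) <= c * `|x|.
Proof.
exists (\sum_(i < n) hnorm form (A 'e_i)) => [|x].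
  by apply: sumr_ge0 => i _; exact: hnorm_ge0.
rewrite {1}(row_sum_delta x) linear_sum mulr_suml.
elim/big_ind2 : _ => [|u a v c ua vc|i _].
- by rewrite /hnorm linear0r sqrtr0.
- by rewrite (le_trans (hnormD _ _ _))// lerD.
- by rewrite linearZ hnormZ mulrC ler_wpM2l ?hnorm_ge0// norm_coord.
Qed.

Lemma dual_objective_continuous z : continuous (fun x => Phi z (A x)).
Proof.
have [c c0 cP] := norm_adj_le; have [c' c'0 c'P] := hnorm_lfun_le.
have adjA x y : `|A^* (A x) - A^* (A y)| <= c * c' * `|x - y|.
  by rewrite -!linearB (le_trans (cP _))//= -mulrA ler_wpM2l.
have cb : continuous (fun x => form b (A x)).
  apply: (@continuous_of_lipschitz _ _ _ (hnorm form b * c')) => x y.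
  rewrite -formNr -formDr -linearB (le_trans (norm_cauchy_schwarz _ _ _))//=.
  by rewrite -mulrA ler_wpM2l ?hnorm_ge0.
have cN : continuous (fun x => N (z + A^* (A x))).
  apply: (@continuous_of_lipschitz _ _ _ (n%:R * (c * c'))) => x y.
  rewrite (le_trans (hnorm_lipschitz _ _))// -mulrA ler_wpM2l//.
  by rewrite opprD addrACA subrr add0r.
have cd : continuous (fun x => dist (z + A^* (A x)) K).
  apply: (@continuous_of_lipschitz _ _ _ (n%:R * (c * c'))) => x y.
  rewrite (le_trans (dist_lipschitz _ _ _ _))// -mulrA ler_wpM2l//.
  by rewrite opprD addrACA subrr add0r.
pose fb x := form b (A x); pose fN x := N (z + A^* (A x)).
pose fd x := dist (z + A^* (A x)) K.
have -> : (fun x => Phi z (A x)) =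
    - fb - cst (2^-1 * N z ^+ 2) + cst 2^-1 \* (fN \* fN) - cst 2^-1 \* (fd \* fd).
  by apply/funext => x; rewrite /dual_objective !expr2.
have cstC (a : R) x : {for x, continuous (cst a : 'rV[R]_n -> R)}.
  exact: cst_continuous.
move=> x; apply: continuousB; [apply: continuousD; [apply: continuousB|]|].
- by apply: continuousN; exact: cb.
- exact: cstC.
- by apply: continuousM; [exact: cstC|apply: continuousM; exact: cN].
- by apply: continuousM; [exact: cstC|apply: continuousM; exact: cd].
Qed.

(** Composing [A] with a projection onto [L] keeps it surjective, since the
    summand [lker A] is lost under [A] anyway; [S] is a right inverse of this
    composite followed by the projection. As [Y] carries no topology of its own,
    the bound on [S] is obtained by factoring it through the injective map
    [A^*], which reduces it to a bound on a linear map of row vectors. *)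
Lemma tangent_section (L : {vspace 'rV[R]_n}) :
  limg A = fullv -> (L + lker A)%VS = fullv ->
  exists (S : Y -> 'rV[R]_n) (c : R), [/\ 0 <= c, forall y, A (S y) = y,
    forall y, S y \in L & forall y, `|S y| <= c * hnorm form y].
Proof.
move=> A_surj LA; pose P := projv L; pose g := (A \o P)%VF.
have g_surj : limg g = fullv.
  have Aker : (A @: lker A)%VS = 0%VS by apply/eqP; rewrite -lkerE.
  by rewrite /g limg_comp /P limg_proj -A_surj -LA limgD Aker addv0.
pose S := (P \o g^-1)%VF.
have AS y : A (S y) = y.
  have := limg_lfunVK (f := g) (x := y); rewrite g_surj memvf => /(_ isT).
  by rewrite /S /g !comp_lfunE.
have adj_inj : lker (linfun (adj form A)) == 0%VS.
  apply/lker0P => u v; rewrite !lfunE /= => uv.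
  apply/eqP; rewrite -subr_eq0; apply/eqP/(@hnorm_eq0 _ _ form).
  rewrite /hnorm -{1}(AS (u - v)) -adjP [adj form A (u - v)]linearB /= uv subrr.
  by rewrite linear0r sqrtr0.
pose Q := (S \o (linfun (adj form A))^-1)%VF.
have SQ y : S y = A^* y *m lin1_mx Q.
  rewrite mul_rV_lin1 /= /Q [RHS]comp_lfunE.
  by rewrite -[adj form A y](lfunE (adj form A)) lker0_lfunK.
have [c c0 cP] := norm_adj_le.
exists S, (n%:R * `|lin1_mx Q| * c); split=> [|//||y].
- by rewrite !mulr_ge0.
- by move=> y; rewrite /S comp_lfunE memv_proj.
- by rewrite SQ (le_trans (norm_mulmx _ _))// -[leRHS]mulrA ler_wpM2l// mulr_ge0.
Qed.
End Dual.

(** * Two-sided approximation of tangent directions and quadratic growth *)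

Section Tangent.
Variables (R : realType) (n : nat) (K : set 'rV[R]_n) (xb : 'rV[R]_n).

(** If [xb + t k *: w k] lies in [K], then [h] vanishes there, and strict
    differentiability bounds the derivative of [h] along [w k] by an arbitrarily
    small multiple of [|w k|]. *)
Lemma tangent_cone_ker m (U : set 'rV[R]_n) (h : 'rV[R]_n -> 'rV[R]_m) v :
  open U -> U xb -> class_C 1 U h -> h xb = 0 ->
  (forall x, K x -> U x -> h x = 0) ->
  tangent_cone K xb v -> v *m 'J h xb = 0.
Proof.
move=> oU Ux Ch hx Kh [t [w [t0 t_0 w_v Kw]]]; set J := 'J h xb.
pose c := n%:R * `|J| + `|v| + 1.
have c0 : 0 < c by rewrite ltr_wpDl// addr_ge0// mulr_ge0.
apply/eqP; rewrite -normr_eq0; apply/eqP/le_anti; rewrite normr_ge0 andbT.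
apply/ler_addgt0Pr => e e0; rewrite add0r.
pose e1 := Num.min 1 (e / c).
have e10 : 0 < e1 by rewrite lt_min ltr01 divr_gt0.
have e11 : e1 <= 1 by rewrite ge_min lexx.
have e1c : e1 * c <= e by rewrite -ler_pdivlMr// ge_min lexx orbT.
have [d d0 dP] := strict_derivative oU Ch Ux e10.
have /nbhs_normP[d' /= d'0 d'U] := open_nbhs_nbhs (conj oU Ux).
have tw_0 : (fun k => t k *: w k) @ \oo --> (0 : 'rV[R]_n).
  by rewrite -(scale0r v); exact: cvgZ.
have near_v : \forall k \near \oo, `|v - w k| < e1.
  by move/cvgrPdist_lt: w_v; exact.
have near_x : \forall k \near \oo, `|0 - t k *: w k| < Num.min d d'.
  by move/cvgrPdist_lt: tw_0; apply; rewrite lt_min d0.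
have [k [kv kx]] := filter_ex (filterI near_v near_x).
rewrite sub0r normrN lt_min in kx; case/andP: kx => kd kd'.
have hk : h (xb + t k *: w k) = 0.
  by apply: Kh; [exact: Kw|apply: d'U; rewrite /= opprD addrA subrr sub0r normrN].
have := dP (xb + t k *: w k) xb.
rewrite hk hx subr0 sub0r normrN (addrC xb) addrK subrr normr0 => /(_ kd d0).
rewrite -scalemxAl !normrZ gtr0_norm// mulrCA ler_pM2l// => wJ.
rewrite -(subrK (w k) v) mulmxDl (le_trans (ler_normD _ _))//.
have := norm_mulmx (v - w k) J.
have := ler_normD (w k - v) v; rewrite subrK distrC => wk H.
apply: le_trans e1c; rewrite /c !mulrDr mulr1.
have : n%:R * `|J| * `|v - w k| <= e1 * (n%:R * `|J|).
  by rewrite mulrC ler_wpM2r ?mulr_ge0// ltW.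
have : e1 * `|w k| <= e1 * (`|v| + 1).
  by rewrite ler_pM2l// (le_trans wk)// addrC lerD2l (le_trans (ltW kv)).
rewrite -/J in wJ; lra.
Qed.

Lemma submanifold_two_sided d (L : {vspace 'rV[R]_n}) (e : R) :
  submanifold 2 d K -> K xb -> [set` L] `<=` tangent_cone K xb -> 0 < e ->
  exists2 r : R, 0 < r & exists2 C : R, 0 <= C &
  forall x0 p, K x0 -> `|x0 - xb| < r -> p \in L -> `|p| < r ->
  exists a a' : 'rV[R]_n, [/\ K (x0 + a), K (x0 + a'),
    `|a - p| <= e * `|p|, `|a' + p| <= e * `|p| & `|a + a'| <= C * `|p| ^+ 2].
Proof.
move=> [_ /(_ xb) Kman] Kxb LT e0; have [U [h [oU Ux Ch hJ KU]]] := Kman Kxb.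
have Kh x : K x -> U x -> h x = 0.
  by move=> Kx Uxx; have : (K `&` U) x by []; rewrite KU => -[].
have hK x : h x = 0 -> U x -> K x.
  by move=> hx Uxx; have : ([set u | h u = 0] `&` U) x by []; rewrite -KU => -[].
have [r1 r10 [C C0 rC]] := zero_set_two_sided oU Ux Ch (hJ xb Ux) e0.
have /nbhs_normP[r2 /= r20 r2U] := open_nbhs_nbhs (conj oU Ux).
exists (Num.min r1 r2); first by rewrite lt_min r10.
exists C => // x0 p Kx0; rewrite !lt_min => /andP[x01 x02] pL /andP[pr _].
have pJ : p *m 'J h xb = 0.
  apply: (tangent_cone_ker oU Ux (class_C2_C1 Ch) (Kh _ Kxb Ux) Kh).
  exact: LT.
have hx0 : h x0 = 0 by apply: Kh => //; apply: r2U; rewrite /= distrC.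
have [a [a' [[ha Ua] [ha' Ua'] ap a'p aa']]] := rC x0 p hx0 x01 pJ pr.
by exists a, a'; split=> //; exact: hK.
Qed.
End Tangent.

Section LocalGrowth.
Variables (R : realType) (n : nat) (Y : vectType R) (form : {dot Y for idfun}).
Variables (A : 'Hom('rV[R]_n, Y)) (b : Y) (K : set 'rV[R]_n) (xb : 'rV[R]_n).
Variable L : {vspace 'rV[R]_n}.
Hypothesis Kxb : K xb.

Local Notation N := (hnorm (@edot R n)).
Local Notation Phi := (dual_objective form A b K).
Local Notation "A^*" := (adj form A).

Hypothesis two_sided : forall e : R, 0 < e ->
  exists2 r : R, 0 < r & exists2 C : R, 0 <= C &
  forall x0 p, K x0 -> `|x0 - xb| < r -> p \in L -> `|p| < r ->
  exists a a' : 'rV[R]_n, [/\ K (x0 + a), K (x0 + a'),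
    `|a - p| <= e * `|p|, `|a' + p| <= e * `|p| & `|a + a'| <= C * `|p| ^+ 2].
Hypotheses (A_surj : limg A = fullv) (LA : (L + lker A)%VS = fullv).

Lemma nearest_point_near w x0 :
  (forall x, K x -> N (w - x0) <= N (w - x)) ->
  `|w - x0| <= n%:R * `|w - xb| /\ `|x0 - xb| <= (n%:R + 1) * `|w - xb|.
Proof.
move=> x0min.
have wx0 : `|w - x0| <= n%:R * `|w - xb|.
  by rewrite (le_trans (norm_le_hnorm _))// (le_trans (x0min _ Kxb))// hnorm_le_norm.
split=> //; have := ler_distD w x0 xb; rewrite (distrC x0 w) mulrDl; lra.
Qed.

(** See the opening explanation: the gain of order [s * |eta|^2] along
    [p = s *: S eta] beats the losses, which are of order [s^2 * |eta|^2]. The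
    constants are uniform for [x0] near [xb], and a nearest point to
    [z + A^* y0] is near [xb] when [z] is near [xb] and [y0] is near [0]. *)
Lemma local_quadratic_growth :
  exists2 r : R, 0 < r & exists2 mu : R, 0 < mu &
  forall z y0 y1 x0, `|z - xb| < r -> hnorm form y0 < r -> hnorm form y1 < r ->
    K x0 -> (forall x, K x -> N (z + A^* y0 - x0) <= N (z + A^* y0 - x)) ->
    Phi z y0 + form (A x0 - b) (y1 - y0) + mu / 2 * hnorm form (y1 - y0) ^+ 2
      <= Phi z y1.
Proof.
have [S [c1 [c10 AS SL Sc]]] := tangent_section form A_surj LA.
have [c2 c20 adjc] := norm_adj_le form A.
have n0 : 0 <= n%:R :> R by [].
(* The error e * |p| of a against p costs at most half of the main term. *)
pose k := n%:R * (c1 * c2); have k0 : 0 <= k by rewrite !mulr_ge0.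
pose e := (2 * (k + 1))^-1.
have e0 : 0 < e by rewrite invr_gt0 mulr_gt0// ltr_wpDl.
have ek : e * k <= 2^-1.
  by rewrite /e mulrC ler_pdivrMr ?mulr_gt0// ?ltr_wpDl//; lra.
have e1 : e <= 1 by rewrite invf_le1 ?mulr_gt0 ?ltr_wpDl//; lra.
have [d d0 [C C0 dC]] := two_sided e0.
(* D collects the coefficients of the losses quadratic in s; s is then chosen
   so that they use up half of the remaining gain. *)
pose D := n%:R * (c1 ^+ 2 * (C + 4)).
have D0 : 0 <= D by rewrite !mulr_ge0// ?sqr_ge0// addr_ge0.
pose s := (4 * (D + 1))^-1.
have s0 : 0 < s by rewrite invr_gt0 mulr_gt0// ltr_wpDl.
have sD : s * D <= 4^-1.
  by rewrite /s mulrC ler_pdivrMr ?mulr_gt0// ?ltr_wpDl//; lra.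
have s1 : s <= 1 by rewrite invf_le1 ?mulr_gt0 ?ltr_wpDl//; lra.
(* M converts a bound r on z - xb, y0 and y1 into bounds on x0 - xb, w - x0
   and p. *)
pose M := (n%:R + 1) * (1 + c2) + 2 * c1.
have M1 : 1 <= M.
  have : 0 <= n%:R * (1 + c2) by rewrite mulr_ge0// addr_ge0.
  by rewrite /M mulrDl; lra.
have M0 : 0 < M by lra.
have [r [r0 rd r1]] : exists r, [/\ 0 < r, M * r <= d & M * r <= 1].
  exists (Num.min d 1 / M).
  rewrite [M * _]mulrC divfK ?gt_eqF// !ge_min !lexx orbT divr_gt0//.
  by rewrite lt_min d0 ltr01.
exists r => //; exists (s / 2); first by rewrite divr_gt0.
move=> z y0 y1 x0 zr y0r y1r Kx0 x0min.
set w := z + A^* y0 in x0min *; set eta := y1 - y0; set E := hnorm form eta.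
have E0 : 0 <= E by exact: hnorm_ge0.
have E2r : E < 2 * r.
  rewrite /E (le_lt_trans (hnormD _ _ _))// hnormN; lra.
have wr : `|w - xb| < (1 + c2) * r.
  rewrite /w addrAC (le_lt_trans (ler_normD _ _))// mulrDl mul1r.
  by rewrite ltr_leD// (le_trans (adjc y0))// ler_wpM2l// ltW.
have wr' : (n%:R + 1) * `|w - xb| < (n%:R + 1) * ((1 + c2) * r).
  by rewrite ltr_pM2l// ltr_wpDl.
have Mr : M * r = (n%:R + 1) * ((1 + c2) * r) + 2 * c1 * r by rewrite /M; ring.
have c1r : 0 <= c1 * r by rewrite mulr_ge0// ltW.
have [wx0 x0xb] := nearest_point_near x0min.
have x0d : `|x0 - xb| < d by lra.
have wx01 : `|w - x0| <= 1.
  by have := normr_ge0 (w - xb); move: wr'; rewrite mulrDl; lra.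
set p := s *: S eta.
have pE : `|p| <= s * (c1 * E).
  by rewrite normrZ gtr0_norm// ler_pM2l.
have pd : `|p| < d.
  have cE : c1 * E <= c1 * (2 * r) by rewrite ler_wpM2l// ltW.
  have : s * (c1 * E) <= c1 * E by rewrite ler_piMl// mulr_ge0.
  have : 0 < (n%:R + 1) * ((1 + c2) * r).
    by apply: mulr_gt0; [|apply: mulr_gt0]; lra.
  lra.
have pL : p \in L by rewrite memvZ.
have [a [a' [Ka Ka' ap a'p aa']]] := dC x0 p Kx0 x0d pL pd.
have pe : e * `|p| <= `|p| by rewrite ler_piMl.
have a2 : `|a| <= 2 * (s * (c1 * E)).
  have := ler_normD (a - p) p; rewrite subrK; lra.
have a'2 : `|a'| <= 2 * (s * (c1 * E)).
  have := ler_normB (a' + p) p; rewrite addrK; lra.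
have sE0 : 0 <= s * (c1 * E) by rewrite (le_trans _ pE).
set q := (s * (c1 * E)) ^+ 2.
have sq_le (v : 'rV[R]_n) : `|v| <= 2 * (s * (c1 * E)) ->
    edot v v <= n%:R * (4 * q).
  move=> v2; rewrite (le_trans (ler_norm _))// (le_trans (norm_edot_le _ _))//.
  rewrite ler_wpM2l// -expr2 /q (_ : 4 * _ = (2 * (s * (c1 * E))) ^+ 2); last by ring.
  by rewrite ler_pXn2r ?nnegrE// mulr_ge0.
have aa'q : `|edot (w - x0) (a + a')| <= n%:R * (C * q).
  rewrite (le_trans (norm_edot_le _ _))// ler_wpM2l//.
  rewrite (le_trans (ler_piMl _ wx01))// (le_trans aa')// ler_wpM2l//.
  by rewrite /q ler_pXn2r ?nnegrE.
have := dual_objective_ge b y1 Kx0 x0min Ka.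
rewrite -/w -/eta (addrC x0 a) addrK.
set lhs := _ + form _ _.
set da := edot (A^* eta) a.
have daE : s / 2 * E ^+ 2 <= da.
  have dp : edot (A^* eta) p = s * E ^+ 2.
    by rewrite edotC adjP linearZ /= AS formZl -sqr_hnorm.
  have : `|edot (A^* eta) (a - p)| <= n%:R * (c2 * E * (e * (s * (c1 * E)))).
    rewrite (le_trans (norm_edot_le _ _))// ler_wpM2l// ler_pM// ?adjc//.
    by rewrite (le_trans ap)// ler_wpM2l// ltW.
  rewrite (_ : n%:R * _ = e * k * (s * E ^+ 2)); last by rewrite /k; ring.
  rewrite ler_norml => /andP[+ _].
  have : e * k * (s * E ^+ 2) <= 2^-1 * (s * E ^+ 2).
    by rewrite ler_wpM2r// mulr_ge0 ?sqr_ge0// ltW.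
  have : edot (A^* eta) (a - p) = da - s * E ^+ 2.
    have := formDr (@edot R n) a (- p) (A^* eta).
    have := formNr (@edot R n) p (A^* eta).
    by rewrite /= -dp /da => -> ->.
  lra.
(* This replaces the normality of w - x0 to K at x0. *)
have wa' : 2 * edot (w - x0) a' <= edot a' a'.
  have := x0min _ Ka'; rewrite -(@ler_pXn2r _ 2)// ?nnegrE ?hnorm_ge0//.
  rewrite !sqr_hnorm opprD addrA /=; set v := w - x0.
  have -> : edot (v - a') (v - a') = edot v v - 2 * edot v a' + edot a' a'.
    have := formDr (@edot R n) v (- a') (v - a').
    have := formDl (@edot R n) v (- a') v.
    have := formDl (@edot R n) v (- a') (- a').
    have := formNr (@edot R n) a' v.
    have := formNl (@edot R n) a' v.
    have := formNl (@edot R n) a' (- a').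
    have := formNr (@edot R n) a' a'.
    have := edotC a' v.
    move=> /=; lra.
  lra.
have waa' : edot (w - x0) (a + a') = edot (w - x0) a + edot (w - x0) a'.
  exact: formDr.
have := sq_le _ a2; have := sq_le _ a'2.
have qE : n%:R * (C * q) + n%:R * (4 * q) = s * D * (s * E ^+ 2).
  by rewrite /q /D; ring.
have : s * D * (s * E ^+ 2) <= 4^-1 * (s * E ^+ 2).
  by rewrite ler_wpM2r// mulr_ge0 ?sqr_ge0// ltW.
move: aa'q; rewrite ler_norml => /andP[+ _]; lra.
Qed.
End LocalGrowth.

(** * Strong convexity and the minimizer *)

Section StrongConvexity.
Variables (R : realType) (Y : lmodType R) (form : {dot Y for idfun}).
Implicit Types (f : Y -> R) (D : set Y) (mu r : R).

Local Notation N := (hnorm form).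

Lemma convex_ball r y1 y2 (t : R) : N y1 < r -> N y2 < r -> 0 <= t <= 1 ->
  N (t *: y1 + (1 - t) *: y2) < r.
Proof.
move=> y1r y2r /andP[t0 t1].
rewrite (le_lt_trans (hnormD _ _ _))// !hnormZ !ger0_norm ?subr_ge0//.
have [M [y1M y2M Mr]] : exists M, [/\ N y1 <= M, N y2 <= M & M < r].
  by exists (Num.max (N y1) (N y2)); rewrite !le_max !lexx orbT gt_max y1r.
nra.
Qed.

(** Apply the hypothesis at [t *: y1 + (1 - t) *: y2], once towards [y1] and
    once towards [y2], and average with weights [t] and [1 - t]: the
    linear terms cancel and the quadratic ones have total weight
    [t (1 - t)^2 + (1 - t) t^2 = t (1 - t)]. *)
Lemma strongly_convex_subgradient mu D f :
  (forall y1 y2 t, D y1 -> D y2 -> 0 <= t <= 1 -> D (t *: y1 + (1 - t) *: y2)) ->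
  (forall y0, D y0 -> exists g, forall y1, D y1 ->
     f y0 + form g (y1 - y0) + mu / 2 * N (y1 - y0) ^+ 2 <= f y1) ->
  strongly_convex_on form mu D f.
Proof.
move=> cD sub y1 y2 t D1 D2 t01; set y := _ + _.
have [g gP] := sub y (cD _ _ _ D1 D2 t01).
have split_at (v : Y) : v = t *: v + (1 - t) *: v.
  by rewrite -scalerDl addrC subrK scale1r.
have e1 : y1 - y = (1 - t) *: (y1 - y2).
  by rewrite {1}(split_at y1) opprD addrACA subrr add0r -scalerBr.
have e2 : y2 - y = - t *: (y1 - y2).
  rewrite {1}(split_at y2) opprD addrACA subrr addr0 -scalerBr.
  by rewrite scaleNr -scalerN opprB.
have := gP _ D1; have := gP _ D2; rewrite e1 e2 !formZr !hnormZ !exprMn.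
rewrite normrN !real_normK ?num_real//; case/andP: t01 => t0 t1.
set d := form g _; set n2 := N _ ^+ 2 => H2 H1.
have := lerD (ler_wpM2l t0 H1) (ler_wpM2l (_ : 0 <= 1 - t) H2).
rewrite subr_ge0 => /(_ t1); nra.
Qed.

(** On the sphere of radius [r / 2] the quadratic term exceeds the linear one,
    so [f > f 0] there; convexity along rays from [0] extends this to all
    farther points. Hence the point provided by the last hypothesis is a global
    minimizer, and all minimizers lie inside that sphere, where strong convexity
    leaves room for one only. *)
Lemma unique_minimizer_of_local_growth f r mu g :
  0 < r -> 0 < mu ->
  strongly_convex_on form 0 setT f ->
  strongly_convex_on form mu [set y | N y < r] f ->
  (forall y, N y < r -> f 0 + form g y + mu / 2 * N y ^+ 2 <= f y) ->
  N g < mu * r / 4 ->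
  (exists y0, f y0 <= f 0 /\ forall y, N y <= r / 2 -> f y0 <= f y) ->
  exists yz, unique (is_minimizer f) yz /\ locally_strongly_convex form f yz.
Proof.
move=> r0 mu0 f_conv f_sconv f_growth gr [yz [fyz0 yz_min]].
have far y : r / 2 <= N y -> f 0 < f y.
  move=> yr; have Ny0 : 0 < N y by apply: lt_le_trans yr; rewrite divr_gt0.
  rewrite ltNge; apply/negP => fy0.
  pose t := r / 2 / N y.
  have t01 : 0 <= t <= 1.
    by rewrite ler_pdivrMr// mul1r yr andbT !divr_ge0// ltW.
  have tN : N (t *: y) = r / 2.
    by case/andP: t01 => t0 _; rewrite hnormZ ger0_norm// divfK// gt_eqF.
  have := f_conv y 0 t I I t01; rewrite scaler0 addr0 !mul0r subr0 => ft.
  have tyr : N (t *: y) < r by rewrite tN; lra.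
  have := f_growth _ tyr; rewrite tN.
  have := norm_cauchy_schwarz form g (t *: y); rewrite tN ler_norml => /andP[+ _].
  have : N g * (r / 2) < mu * r / 4 * (r / 2) by rewrite ltr_pM2r// divr_gt0.
  case/andP: t01 => t0 t1.
  have : t * f y <= t * f 0 by rewrite ler_wpM2l.
  nra.
have glob y : f yz <= f y.
  have [yr|yr] := leP (N y) (r / 2); first exact: yz_min.
  by rewrite (le_trans fyz0)// ltW// far// ltW.
have near0 y : is_minimizer f y -> N y < r / 2.
  by move=> ym; rewrite ltNge; apply/negP => /far; rewrite ltNge ym.
exists yz; split; [split=> // y ym|].
  have [yr yzr] := (near0 y ym, near0 yz glob).
  have half : 0 <= (2^-1 : R) <= 1 by lra.
  have := f_sconv yz y _ _ _ half; rewrite /= => H.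
  have {}H := H (lt_trans yzr _) (lt_trans yr _).
  have r2 : r / 2 < r by lra.
  have {H} := H r2 r2.
  have := glob (2^-1 *: yz + (1 - 2^-1) *: y).
  have := ym yz.
  have := hnorm_ge0 form (yz - y); set d := N _ => d0 H1 H2 H3.
  have : d = 0.
    suff : mu * d ^+ 2 <= 0.
      by rewrite pmulr_rle0// => d2; apply/eqP; rewrite -sqrf_eq0 eq_le d2 sqr_ge0.
    have := glob y; lra.
  by move/hnorm_eq0/subr0_eq.
exists (r / 2), mu; split=> //; first by rewrite divr_gt0.
move=> y1 y2 t /= y1r y2r; apply: f_sconv => /=.
  have := hnormD form (y1 - yz) yz; rewrite subrK; have := near0 _ glob; lra.
have := hnormD form (y2 - yz) yz; rewrite subrK; have := near0 _ glob; lra.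
Qed.
End StrongConvexity.

Theorem theorem6 (R : realType) (n : nat) (Y : vectType R)
    (form : {dot Y for idfun}) (A : 'Hom('rV[R]_n, Y)) (b : Y)
    (K : set 'rV[R]_n) (xbar : 'rV[R]_n)
    (A_surj : limg A = fullv)
    (K_closed : closed K)
    (F_nonempty : K `&` [set x | A x = b] !=set0)
    (K_submanifold : exists d, submanifold 2 d K)
    (xbar_feasible : (K `&` [set x | A x = b]) xbar)
    (xbar_nondegenerate : nondegenerate_at A K xbar) :
  \forall z \near xbar,
    exists yz : Y,
      unique (is_minimizer (dual_objective form A b K z)) yz /\
      locally_strongly_convex form (dual_objective form A b K z) yz.
Proof.
case: xbar_feasible => Kxbar /= Axbar.
case: xbar_nondegenerate => L [LT _] LA; case: K_submanifold => d Kd.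
have K0 : K !=set0 by exists xbar.
have [r r0 [mu mu0 growth]] := local_quadratic_growth form b Kxbar
  (fun e => @submanifold_two_sided _ _ _ _ _ _ e Kd Kxbar LT) A_surj LA.
have [c c0 Ac] := hnorm_lfun_le form A.
have [S [c1 [c10 AS _ Sc]]] := tangent_section form A_surj LA.
(* The norm of the subgradient A x0 - b at 0 is at most k * |z - xbar|. *)
pose k := c * (n%:R + 1) + 1.
have k0 : 0 < k by rewrite ltr_wpDl// mulr_ge0// addr_ge0.
pose rho := Num.min r (mu * r / 4 / k).
have rho0 : 0 < rho by rewrite lt_min r0 !divr_gt0// mulr_gt0.
apply/(@nbhs_normP R 'rV[R]_n xbar); exists rho => // z.
rewrite /ball_ /= distrC lt_min => /andP[zr zk].
pose f := dual_objective form A b K z; rewrite -/f.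
have near_pt y := nearest_point (z + adj form A y) K_closed K0.
have adj0 : adj form A 0 = 0 by exact: linear0.
have hn0 : hnorm form 0 = 0 by rewrite /hnorm linear0r sqrtr0.
have [x0 Kx0 x0min] := near_pt 0.
apply: (@unique_minimizer_of_local_growth _ _ _ f r mu (A x0 - b)) => //.
- apply: strongly_convex_subgradient => // y0 _; have [x Kx xmin] := near_pt y0.
  exists (A x - b) => y1 _; rewrite !mul0r addr0.
  exact: dual_objective_subgradient Kx xmin.
- apply: strongly_convex_subgradient; first by move=> *; exact: convex_ball.
  move=> y0 /= y0r; have [x Kx xmin] := near_pt y0.
  by exists (A x - b) => y1 /= y1r; exact: growth.
- move=> y yr; have := growth z 0 y x0 zr _ yr Kx0 x0min.
  by rewrite !subr0 hn0; apply.
- have [_] := nearest_point_near Kxbar x0min; rewrite adj0 addr0 => x0xbar.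
  rewrite -Axbar -linearB (le_lt_trans (Ac _))//.
  rewrite (@le_lt_trans _ _ (k * `|z - xbar|))//; last first.
    by rewrite mulrC -ltr_pdivlMr.
  rewrite (le_trans (ler_wpM2l c0 x0xbar))// mulrA ler_wpM2r//.
  by rewrite /k lerDl.
(* Compactness is used in the domain of A: the image under A of this ball
   contains the ball of radius r / 2 of Y. *)
pose C := closed_ball_ Num.norm (0 : 'rV[R]_n) (c1 * (r / 2)).
have C0 : C 0 by rewrite /C /closed_ball_ /= subr0 normr0 mulr_ge0// divr_ge0// ltW.
have Ccl : closed C by exact: closed_closed_ball_.
have Cbd : bounded_set C.
  exists (c1 * (r / 2)); split; first exact: num_real.
  move=> M HM x; rewrite /C /closed_ball_ /= sub0r normrN => xC.
  exact: le_trans (ltW HM).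
have [x Cx xmin] := compact_EVT_min (ex_intro _ 0 C0)
  (bounded_closed_compact Cbd Ccl)
  (continuous_subspaceT (@dual_objective_continuous _ _ _ form A b K K_closed K0 z)).
exists (A x); split.
  by have := xmin 0 (mem_set C0); rewrite linear0.
move=> y yr; rewrite -{1}(AS y); apply: xmin; apply/mem_set.
by rewrite /C /closed_ball_ /= sub0r normrN (le_trans (Sc y))// ler_wpM2l.
Qed.
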